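(* Let $n,k\ge1$ and $m=\min(k+1,n)$. The order of rowmotion $\rho$ on $\mathcal{J}({\sf C}_n\times[k])$ is $(k+2)\,\mathrm{LCM}(1,2,\dots,m)$.
   Context: The claw poset ${\sf C}_n=\{b_1,\dots,b_n,\widehat0\}$ has relations $\widehat0<b_i$ for all $i$ and no other relations ($b_1,\dots,b_n$ pairwise incomparable). $[k]=\{1<\dots<k\}$ and ${\sf C}_n\times[k]$ carries the product order. $\mathcal{J}(P)$ is the set of order ideals of $P$; rowmotion $\rho$ sends an order ideal $I$ to the order ideal generated by the minimal elements of $P\setminus I$. The order of $\rho$ is the least $N\ge1$ with $\rho^N=\mathrm{id}$. *)

(* Defs.v *)
From HB Require Import structures.
From mathcomp Require Import all_boot all_order.

Set Implicit Arguments.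
Unset Strict Implicit.
Unset Printing Implicit Defensive.

Import Order.TTheory.
Local Open Scope order_scope.

Section Rowmotion.
Variables (d : Order.disp_t) (P : finPOrderType d).
Implicit Types (A I : {set P}).

Definition order_ideal I : bool :=
  [forall x in I, forall y, (y <= x) ==> (y \in I)].

Definition ideals : predArgType := {I : {set P} | order_ideal I}.

Definition minimals A : {set P} :=
  [set x in A | [forall y in A, ~~ (y < x)]].

Definition generated_ideal A : {set P} := [set y | [exists x in A, y <= x]].

Lemma generated_idealP A : order_ideal (generated_ideal A).
Proof.
apply/forall_inP => x; rewrite inE => /exists_inP[z zA le_xz].
apply/forall_inP => y le_yx; rewrite inE; apply/exists_inP.
by exists z => //; apply: le_trans le_yx le_xz.
Qed.

Definition rowmotion (I : ideals) : ideals :=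
  exist _ (generated_ideal (minimals (~: val I))) (generated_idealP _).

End Rowmotion.

Arguments ideals {d} P.

Definition is_order (T : Type) (f : T -> T) (N : nat) : Prop :=
  [/\ (0 < N)%N, iter N f =1 id &
      forall M, (0 < M)%N -> iter M f =1 id -> (N <= M)%N].

Variant claw (n : nat) : Type := Claw_bot | Claw_leaf of 'I_n.
Arguments Claw_bot {n}.

Section ClawPoset.
Variable n : nat.

Definition claw_opt (x : claw n) : option 'I_n :=
  if x is Claw_leaf i then Some i else None.
Definition opt_claw (o : option 'I_n) : claw n :=
  if o is Some i then Claw_leaf i else Claw_bot.
Lemma claw_optK : cancel claw_opt opt_claw. Proof. by case. Qed.

HB.instance Definition _ := Finite.copy (claw n) (can_type claw_optK).

Definition claw_le (x y : claw n) : bool :=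
  match x, y with
  | Claw_bot, _ => true
  | Claw_leaf i, Claw_leaf j => i == j
  | Claw_leaf _, Claw_bot => false
  end.

Fact claw_le_refl : reflexive claw_le.
Proof. by case=> //= i. Qed.
Fact claw_le_anti : antisymmetric claw_le.
Proof. by move=> [|i] [|j] //= /andP[/eqP->]. Qed.
Fact claw_le_trans : transitive claw_le.
Proof. by move=> [|i] [|j] [|k] //= /eqP-> /eqP->. Qed.

Fact claw_display : Order.disp_t. Proof. exact: (Order.Disp tt tt). Qed.

HB.instance Definition _ := Order.Le_isPOrder.Build claw_display (claw n)
  claw_le_refl claw_le_anti claw_le_trans.

End ClawPoset.

(* Main.v *)
Require Import Defs.
From HB Require Import structures.
From mathcomp Require Import all_boot all_order.
From mathcomp Require Import zify.

Set Implicit Arguments.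
Unset Strict Implicit.
Unset Printing Implicit Defensive.

Import Order.TTheory.

(** An ideal of [C_n x [k]] is a tuple [(a; c_1, .., c_n)] with
    [c_i <= a <= k]: the lengths of its chains over the bottom and the leaves.
    Let [U] replace each [c_i] by [c_i + 1] modulo [a + 1], and let [V] replace
    [a] by [a + 1], or by [max c_i] when [a = k].  Both are injective and
    rowmotion is [V U], so it has the same order as [U V].

    Write the distinct values of the [c_i], together with [a + 1], as the set of
    ones of a binary word [w] of length [k + 2], and let [f i] be the rank of
    [c_i] among the [l] distinct values.  Then [U V] rotates [w] by one position
    and increases [f] by one modulo [l] whenever a one passes the end of the
    word.  A full turn of [k + 2] steps involves [l + 1] passages, so it fixes
    [w] and adds [1] to [f] modulo [l].  All [l <= min (k + 1, n)] occur. *)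

Lemma iter_semiconj (T U : Type) (f : T -> T) (g : U -> U) (h : T -> U)
    (p : pred T) :
  (forall x, p x -> p (f x)) -> (forall x, p x -> h (f x) = g (h x)) ->
  forall m x, p x -> p (iter m f x) /\ h (iter m f x) = iter m g (h x).
Proof.
move=> pf hf; elim=> [|m IHm] x px //=.
by have [pm hm] := IHm x px; rewrite hf // hm; split=> //; apply: pf.
Qed.

(** * Rowmotion on tuples as a product of two injections *)

Section States.
Variable n : nat.
Implicit Types (f c : {ffun 'I_n -> nat}) (w : seq bool).

Definition state : Type := (nat * {ffun 'I_n -> nat})%type.
Implicit Type s : state.

Definition valid k s := (s.1 <= k) && [forall i, s.2 i <= s.1].

(** [leaf_step] is the map [U] and [bot_step] is the map [V]. *)
Definition leaf_step s : state :=
  (s.1, [ffun i => if s.2 i < s.1 then (s.2 i).+1 else 0]).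

Definition bot_step k s : state :=
  (if s.1 < k then s.1.+1 else \max_i s.2 i, s.2).

Definition row k s := bot_step k (leaf_step s).

Definition prom k s := leaf_step (bot_step k s).

Lemma validP k s : reflect (s.1 <= k /\ forall i, s.2 i <= s.1) (valid k s).
Proof.
apply: (iffP andP) => [[ak /forallP]|[ak cs]] //.
by split=> //; apply/forallP.
Qed.

Lemma leaf_step_valid k s : valid k s -> valid k (leaf_step s).
Proof.
move/validP=> [ak cs]; apply/validP; split=> //= i.
by rewrite ffunE; case: ifP.
Qed.

Lemma bot_step_valid k s : valid k s -> valid k (bot_step k s).
Proof.
move/validP=> [ak cs]; apply/validP; rewrite /bot_step /=; case: ifP => ak'.
  by split=> // i; apply: leqW.
split=> [|i]; last exact: leq_bigmax.
by apply: leq_trans ak; apply/bigmax_leqP.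
Qed.

Lemma leaf_step_inj k :
  {in [pred s | valid k s] &, injective leaf_step}.
Proof.
move=> [a c] [b e] /validP[/= _ ca] /validP[/= _ eb] [ab /ffunP ce].
subst b; congr pair; apply/ffunP => i.
by move: (ce i) (ca i) (eb i); rewrite !ffunE /=; case: ifP; case: ifP; lia.
Qed.

(** The two branches cannot collide: [a + 1] exceeds every [c_i], whereas the other value is their
    maximum. *)
Lemma bot_step_inj k :
  {in [pred s | valid k s] &, injective (bot_step k)}.
Proof.
move=> [a c] [b e] /validP[/= ak ca] /validP[/= bk eb] [ab ce].
subst e; congr pair.
have ma : \max_i c i <= a by apply/bigmax_leqP.
have mb : \max_i c i <= b by apply/bigmax_leqP.
move: ab ma mb; move: (\max_i c i) => M /=.
by case: ifP; case: ifP; lia.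
Qed.

(** [bot_step] carries [prom] to [row], and [leaf_step] carries [row] to [prom]. Each implication
    transports the iterate along one of these maps, then cancels that map by its injectivity on
    valid tuples. *)
Lemma iter_row_id k m :
  (forall s, valid k s -> iter m (row k) s = s) <->
  (forall s, valid k s -> iter m (prom k) s = s).
Proof.
have pv s : valid k s -> valid k (prom k s).
  by move=> vs; apply/leaf_step_valid/bot_step_valid.
have rv s : valid k s -> valid k (row k s).
  by move=> vs; apply/bot_step_valid/leaf_step_valid.
split=> idm s vs.
  have [] := iter_semiconj (h := bot_step k) (g := row k) pv
    (fun _ _ => erefl) m vs.
  by rewrite idm; [move=> vm /(bot_step_inj vm vs) | apply: bot_step_valid].
have [] := iter_semiconj (h := leaf_step) (g := prom k) rv
  (fun _ _ => erefl) m vs.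
by rewrite idm; [move=> vm /(leaf_step_inj vm vs) | apply: leaf_step_valid].
Qed.

(** * Binary words encoding the tuples *)

Definition ones w := mask w (iota 0 (size w)).

(* The last one of [w] stands for [a + 1], the others for the values [c_i]. *)
Definition decode w f : state :=
  ((last 0 (ones w)).-1, [ffun i => nth 0 (ones w) (f i)]).

Definition shift l m f := [ffun i => (f i + m) %% l].

(** Surjectivity of [f] says that every one except the last is a value taken by some leaf; hence the
    one before the last is the maximum of the [c_i]. *)
Definition coded k l w f : Prop :=
  [/\ 0 < l, size w = k.+2, count id w = l.+1,
      forall i, f i < l & forall j, j < l -> exists i, f i = j].

Lemma ones_cons b w : ones (b :: w) = nseq b 0 ++ map S (ones w).
Proof.
rewrite /ones mask_cons map_mask; congr (_ ++ mask _ _).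
exact: (iotaDl 1 0).
Qed.

Lemma ones_rcons b w : ones (rcons w b) = ones w ++ nseq b (size w).
Proof.
rewrite /ones size_rcons -addn1 iotaD -cats1 mask_cat ?size_iota //=.
by case: b.
Qed.

Lemma size_ones w : size (ones w) = count id w.
Proof. by rewrite size_mask ?size_iota. Qed.

Lemma ones_lt w x : x \in ones w -> x < size w.
Proof. by move/mem_mask; rewrite mem_iota. Qed.

Lemma ones_nth_ltn w i j :
  i < j -> j < count id w -> nth 0 (ones w) i < nth 0 (ones w) j.
Proof.
move=> ij jw.
have sw : sorted ltn (ones w).
  by apply: (sorted_mask ltn_trans); apply: iota_ltn_sorted.
apply: (sorted_ltn_nth ltn_trans) => //; rewrite inE size_ones //.
exact: ltn_trans jw.
Qed.

Lemma shift_shift l m p f : shift l m (shift l p f) = shift l (p + m) f.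
Proof. by apply/ffunP=> i; rewrite !ffunE modnDml addnA. Qed.

Lemma shift_onto l m f :
  (forall j, j < l -> exists i, f i = j) ->
  forall j, j < l -> exists i, shift l m f i = j.
Proof.
move=> onto j jl.
have l0 : 0 < l by lia.
have [i fi] := onto ((j + (l - m %% l)) %% l) (ltn_pmod _ l0).
exists i; rewrite ffunE fi modnDml -addnA -modnDmr -(modnDmr (l - _) m).
by rewrite (subnK (ltnW (ltn_pmod m l0))) modnn addn0 modn_small.
Qed.

Lemma prom_decode k l w b f : coded k l (rcons w b) f ->
  prom k (decode (rcons w b) f) = decode (b :: w) (shift l b f)
  /\ coded k l (b :: w) (shift l b f).
Proof.
case; rewrite size_rcons => l0 [sw].
rewrite -cats1 count_cat /= addn0 cats1 => cw fl onto.
split; last first.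
  split=> //=; first by rewrite sw.
  - by rewrite addnC.
  - by move=> i; rewrite ffunE ltn_pmod.
  - exact: shift_onto.
rewrite /decode ones_cons ones_rcons sw.
have fcw i : f i < count id w by have := fl i; case: b cw => /=; lia.
have nthr b' y i : nth 0 (ones w ++ nseq b' y) (f i) = nth 0 (ones w) (f i).
  by rewrite nth_cat size_ones fcw.
have lastw : last 0 (ones w) = nth 0 (ones w) (count id w).-1.
  by rewrite -size_ones nth_last.
have lastS : last 0 (map S (ones w)) = (last 0 (ones w)).+1.
  rewrite lastw -size_ones.
  case: (ones w) (size_ones w) => [|x p] /=; last by rewrite last_map nth_last.
  by case: b cw => /=; lia.
case: b cw => cw.
  (* The final bit is a one: [a = k], so [bot_step] sets [a] to the last one of [w], the largest
     [c_i]. The leaves of rank [l - 1] attain it and wrap to 0, the new first one; all others move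
     up one rank. *)
  have cl : count id w = l by move: cw => /=; lia.
  rewrite /prom /bot_step /leaf_step /= last_cat /= ltnn.
  have -> : \max_i [ffun i => nth 0 (ones w ++ [:: k.+1]) (f i)] i
            = last 0 (ones w).
    apply/eqP; rewrite eqn_leq; apply/andP; split.
      apply/bigmax_leqP => i _; rewrite ffunE (nthr true) lastw cl.
      have [->//|fil] := eqVneq (f i) l.-1.
      by apply/ltnW/ones_nth_ltn; rewrite ?cl; have := fl i; lia.
    have [i fi] : exists i, f i = l.-1 by apply: onto; lia.
    rewrite lastw cl -fi -(nthr true k.+1).
    have := @leq_bigmax _ (fun i => [ffun i => nth 0 (ones w ++ [:: k.+1]) (f i)] i) i.
    by rewrite ffunE.
  congr pair; first by rewrite lastS.
  apply/ffunP => i; rewrite !ffunE (nthr true) lastw cl /= addn1.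
  have [fil|fil] := eqVneq (f i) l.-1.
    by rewrite fil ltnn prednK // modnn.
  have fil' : (f i).+1 < l by have := fl i; lia.
  by rewrite ones_nth_ltn ?cl ?modn_small //= ?(nth_map 0) ?size_ones //; lia.
(* The final bit is a zero: [a < k], so [a] becomes the last one of [w], strictly above every [c_i].
   No leaf wraps, and the ranks do not change. *)
have cl : count id w = l.+1 by move: cw => /=; lia.
rewrite /prom /bot_step /leaf_step /= cats0 lastS /= lastw cl /=.
have flt i : nth 0 (ones w) (f i) < nth 0 (ones w) l.
  by apply: ones_nth_ltn; rewrite ?cl.
have [i0 _] := onto 0 l0.
have lk : nth 0 (ones w) l < k.+1.
  by rewrite -sw; apply/ones_lt/mem_nth; rewrite size_ones cl.
have -> : (nth 0 (ones w) l).-1 < k by have := flt i0; lia.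
congr pair; first by have := flt i0; lia.
apply/ffunP => i; rewrite !ffunE addn0 modn_small //.
by rewrite (nth_map 0) ?size_ones // prednK ?flt //; have := flt i; lia.
Qed.

(** The split lets the induction move the bits of [w2], starting from its end, to the front of
    [w1]. *)
Lemma iter_prom_decode k l w1 w2 f : coded k l (w1 ++ w2) f ->
  iter (size w2) (prom k) (decode (w1 ++ w2) f)
    = decode (w2 ++ w1) (shift l (count id w2) f).
Proof.
elim/last_ind: w2 w1 f => [|w2 b IH] w1 f.
  rewrite cats0 /= => -[_ _ _ fl _]; congr decode.
  by apply/ffunP => i; rewrite ffunE addn0 modn_small.
rewrite -rcons_cat => /prom_decode[e cf].
rewrite size_rcons iterSr e (IH (b :: w1)) // shift_shift cat_rcons.
by rewrite -cats1 count_cat /= addn0 addnC.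
Qed.

Lemma shift_coded k l w m f : coded k l w f -> coded k l w (shift l m f).
Proof.
case=> l0 sw cw fl onto; split=> //; last exact: shift_onto.
by move=> i; rewrite ffunE ltn_pmod.
Qed.

Lemma iter_prom_turns k l w f q : coded k l w f ->
  iter (k.+2 * q) (prom k) (decode w f) = decode w (shift l q f).
Proof.
elim: q f => [|q IH] f cf.
  rewrite muln0 /=; case: cf => _ _ _ fl _; congr decode.
  by apply/ffunP => i; rewrite ffunE addn0 modn_small.
rewrite mulnS addnC iterD.
have [_ sw cw _ _] := cf.
have := @iter_prom_decode k l [::] w f cf; rewrite sw cats0 => ->.
rewrite IH ?shift_shift; last exact: shift_coded.
by congr decode; apply/ffunP => i; rewrite !ffunE cw addSnnS addnCA modnDl.
Qed.

(** The bound on [l] counts the distinct values: they lie in [0, .., a] with [a <= k], and there are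
    [n] leaves. The length [k + 2] leaves room for the position [a + 1]. *)
Lemma valid_coded k s : 0 < n -> valid k s ->
  exists l w f, [/\ l <= minn k.+1 n, coded k l w f & s = decode w f].
Proof.
case: s => a c n0 /validP[/= ak ca].
pose d j := j \in codom c.
pose x := filter d (iota 0 a.+1).
have cx i : c i \in x.
  by rewrite mem_filter /d codom_f mem_iota /= ltnS ca.
pose w := [seq d j || (j == a.+1) | j <- iota 0 k.+2].
have ow : ones w = rcons x a.+1.
  rewrite /ones size_map size_iota /w -filter_mask.
  (* Below [a + 1] the filter keeps exactly the values; from there on it keeps only [a + 1], since
     every [c_i <= a]. *)
  have -> : k.+2 = a.+1 + (k - a).+1 by lia.
  rewrite iotaD filter_cat -cats1; congr (_ ++ _).
    apply: eq_in_filter => j; rewrite mem_iota add0n => /andP[_ ja].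
    by rewrite (ltn_eqF ja) orbF.
  rewrite add0n /= eqxx orbT -(filter_pred0 (iota a.+2 (k - a))).
  congr cons.
  apply: eq_in_filter => j; rewrite mem_iota => /andP[ja _] /=.
  rewrite (gtn_eqF ja) orbF; apply/negP => /codomP[i ji].
  by have := ca i; rewrite -ji; lia.
have ux : uniq x by rewrite filter_uniq ?iota_uniq.
exists (size x), w, [ffun i => index (c i) x]; split.
- rewrite leq_min; apply/andP; split.
    by rewrite size_filter (leq_trans (count_size _ _)) // size_iota.
  have -> : n = size (codom c) by rewrite size_codom card_ord.
  by apply: uniq_leq_size => // j; rewrite mem_filter => /andP[].
- split.
  + by case: x cx {ow ux} => // /(_ (Ordinal n0)).
  + by rewrite size_map size_iota.
  + by rewrite -size_ones ow size_rcons.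
  + by move=> i; rewrite ffunE index_mem.
  move=> j jx; have := mem_nth 0 jx; rewrite mem_filter => /andP[/codomP[i e] _].
  by exists i; rewrite ffunE -e index_uniq.
rewrite /decode ow last_rcons; congr pair; apply/ffunP => i; rewrite !ffunE.
by rewrite nth_rcons index_mem cx nth_index.
Qed.

End States.

(** * The order of [prom] *)

Lemma prom_iter_lcm n k (s : state n) : 0 < n -> valid k s ->
  iter (k.+2 * \big[lcmn/1]_(1 <= i < (minn k.+1 n).+1) i) (prom k) s = s.
Proof.
move=> n0 /(valid_coded n0)[l [w [f [ln cf ->]]]].
rewrite (iter_prom_turns _ cf); have [l0 _ _ fl _] := cf.
congr decode; apply/ffunP => i; rewrite ffunE.
have /dvdnP[r ->] : l %| \big[lcmn/1]_(1 <= i < (minn k.+1 n).+1) i.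
  rewrite big_geq_mkord.
  exact: (biglcmn_sup (Ordinal (ln : l < (minn k.+1 n).+1))).
by rewrite addnC modnMDl modn_small.
Qed.

(** The start is the empty ideal. Until [a] reaches [k] no leaf wraps, so all chains grow
    together. *)
Lemma iter_prom_bottom n k r : r <= k ->
  iter r (@prom n k) (0, [ffun=> 0]) = (r, [ffun=> r]).
Proof.
elim: r => [|r IH] rk //=; rewrite IH; last exact: ltnW.
rewrite /prom /bot_step /leaf_step /= rk; congr pair; apply/ffunP => i.
by rewrite !ffunE ltnS leqnn.
Qed.

(* The word [1 1 0 .. 0] is fixed by no proper rotation, which forces the
   factor [k + 2]; the words [1^(l+1) 0 .. 0] force the factors [l]. *)
Lemma prom_iter_id_dvdn n k q : 0 < n -> 0 < k ->
  (forall s : state n, valid k s -> iter q (prom k) s = s) ->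
  k.+2 * \big[lcmn/1]_(1 <= i < (minn k.+1 n).+1) i %| q.
Proof.
move=> n0 k0 idq.
pose w l := nseq l.+1 true ++ nseq (k.+1 - l) false.
(* This is onto [0, .., l - 1] once [l <= n], and sends leaf 0 to 0. *)
pose f l := [ffun i : 'I_n => minn i l.-1].
have cf l : 0 < l -> l <= minn k.+1 n -> coded k l (w l) (f l).
  rewrite leq_min => l0 /andP[lk ln]; split=> //.
  - by rewrite size_cat !size_nseq; lia.
  - by rewrite count_cat !count_nseq /=; lia.
  - by move=> i; rewrite ffunE; lia.
  by move=> j jl; exists (Ordinal (leq_trans jl ln)); rewrite ffunE /=; lia.
have ow l : l <= k.+1 -> ones (w l) = iota 0 l.+1.
  move=> lk; rewrite /ones size_cat !size_nseq iotaD.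
  rewrite mask_cat ?size_nseq ?size_iota // mask_true ?size_iota //.
  by rewrite mask_false cats0.
(* The ones of [w l] are [0, .., l], so values and ranks coincide. *)
have de l (g : {ffun 'I_n -> nat}) : 0 < l -> l <= k.+1 ->
    (forall i, g i < l) -> decode (w l) g = (l.-1, g).
  move=> l0 lk gl; rewrite /decode ow // -addn1 iotaD last_cat /=.
  congr pair; apply/ffunP => i; rewrite ffunE nth_cat size_iota gl.
  by rewrite nth_iota.
have turn l p : 0 < l -> l <= minn k.+1 n ->
    iter (k.+2 * p) (prom k) (l.-1, f l) = (l.-1, shift l p (f l)).
  move=> l0 ln; have cfl := cf l l0 ln; have [_ _ _ fl _] := cfl.
  have [_ _ _ sl _] := shift_coded p cfl.
  have lk : l <= k.+1 by move: ln; rewrite leq_min => /andP[].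
  by rewrite -(de l) // (iter_prom_turns _ cfl) de.
have vl l : 0 < l -> l <= k.+1 -> valid k (l.-1, f l).
  by move=> l0 lk; apply/validP; split=> /= [|i]; rewrite ?ffunE; lia.
have m0 : 0 < minn k.+1 n by rewrite leq_min n0.
(* For [l = 1] the state is the empty ideal, which full turns fix, so only the remainder [r] of [q]
   matters. If [r <= k] the tuple reached is [(r; r, .., r)], forcing [r = 0]; if [r = k + 1] its
   bottom entry is [k], not 0. *)
have kq : k.+2 %| q.
  have f1 : f 1 = [ffun=> 0] by apply/ffunP => i; rewrite !ffunE minn0.
  have := idq _ (vl 1 isT isT).
  rewrite {1}(divn_eq q k.+2) addnC iterD mulnC turn // f1.
  have -> : shift 1 (q %/ k.+2) [ffun=> 0] = [ffun=> 0] :> {ffun 'I_n -> nat}.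
    by apply/ffunP => i; rewrite !ffunE modn1.
  rewrite /dvdn; have := ltn_pmod q (isT : 0 < k.+2).
  rewrite ltnS leq_eqVlt => /orP[/eqP->|]; last first.
    by rewrite ltnS => rk; rewrite iter_prom_bottom // => /(congr1 fst)/= ->.
  rewrite iterS iter_prom_bottom // /prom /bot_step /= ltnn => /(congr1 fst)/=.
  have := @leq_bigmax _ (fun i : 'I_n => [ffun=> k] i) (Ordinal n0).
  by rewrite ffunE => + e; rewrite e leqNgt k0.
have := kq => /dvdnP[p e]; rewrite e mulnC dvdn_pmul2r // big_geq_mkord.
apply/dvdn_biglcmP => -[l /= ln] l0.
have lk : l <= k.+1 by move: ln; rewrite ltnS leq_min => /andP[].
(* After [p] turns leaf 0 has value [p %% l], which must again be 0. *)
have := idq _ (vl l l0 lk); rewrite e mulnC turn // => -[] /ffunP/(_ (Ordinal n0)).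
by rewrite !ffunE /= min0n add0n => /eqP.
Qed.

(** * Order ideals as tuples of chain lengths *)

Lemma card_ord_lt k m : m <= k -> #|[set i : 'I_k | i < m]| = m.
Proof.
move=> mk; have winj : injective (widen_ord mk).
  by move=> i j /(congr1 val) ij; apply: val_inj.
rewrite -[RHS]card_ord -(card_imset _ winj).
apply: eq_card => i; rewrite inE; apply/idP/imsetP => [im|[j _ ->]] //=.
by exists (Ordinal im) => //; apply: val_inj.
Qed.

(** If [j] is in [D], then [D] contains the initial segment of size [j + 1]; otherwise [D] lies
    inside the one of size [j]. *)
Lemma mem_down_set k (D : {set 'I_k}) :
  (forall i j : 'I_k, i <= j -> j \in D -> i \in D) ->
  forall j, (j \in D) = (j < #|D|).
Proof.
move=> down j; apply/idP/idP => [jD|].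
  rewrite -(card_ord_lt (ltn_ord j)); apply: subset_leq_card.
  by apply/subsetP => i; rewrite inE ltnS => /down; apply.
apply: contraLR => jD; rewrite -leqNgt -[leqRHS](card_ord_lt (ltnW (ltn_ord j))).
apply: subset_leq_card; apply/subsetP => i iD; rewrite inE ltnNge.
by apply: contra jD => /down; apply.
Qed.

Lemma mem_minimals d (T : finPOrderType d) (A : {set T}) x :
  reflect (x \in A /\ forall y, y \in A -> (y <= x)%O -> y = x)
          (x \in minimals A).
Proof.
rewrite inE; apply: (iffP andP) => [] [xA] => [/forall_inP|] mx; split=> //.
  move=> y yA; rewrite le_eqVlt => /orP[/eqP//|yx].
  by have := mx y yA; rewrite yx.
apply/forall_inP => y yA; apply/negP => yx.
by have := yx; rewrite (mx y yA (ltW yx)) ltxx.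
Qed.

Section Ideals.
Variables n k : nat.
Local Notation P := (claw n *p 'I_k)%type.
Implicit Types (I : {set P}) (s : state n).

Definition encode I : state n :=
  (#|[set j | ((Claw_bot, j) : P) \in I]|,
   [ffun i => #|[set j | ((Claw_leaf i, j) : P) \in I]|]).

Definition ideal_of s : {set P} :=
  [set x : P | x.2 < (if x.1 is Claw_leaf i then s.2 i else s.1)].

Lemma le_clawE (x y : P) : (x <= y)%O = claw_le x.1 y.1 && (x.2 <= y.2).
Proof. by []. Qed.

Lemma ideal_of_order_ideal s : valid k s -> order_ideal (ideal_of s).
Proof.
move=> /validP[_ ca]; apply/forall_inP => -[x i]; rewrite inE /= => xi.
apply/forall_inP => -[y j]; rewrite le_clawE inE /= => /andP[yx ji].
apply: leq_ltn_trans ji _; case: y x xi yx => [|a] [|b] //= xi.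
  by move=> _; apply: leq_trans xi (ca b).
by move/eqP->.
Qed.

Lemma ideal_ofK s : valid k s -> encode (ideal_of s) = s.
Proof.
case: s => a c /validP[/= ak ca]; congr pair.
  by rewrite -[RHS](card_ord_lt ak); apply: eq_card => j; rewrite !inE.
apply/ffunP => i; rewrite ffunE -[RHS](card_ord_lt (leq_trans (ca i) ak)).
by apply: eq_card => j; rewrite !inE.
Qed.

Lemma encodeK I : order_ideal I -> ideal_of (encode I) = I.
Proof.
move=> /forall_inP oI.
have down (x y : P) : (y <= x)%O -> x \in I -> y \in I.
  by move=> yx xI; have /forall_inP := oI x xI; apply.
apply/setP => -[[|a] j]; rewrite inE /= ?ffunE -mem_down_set ?inE // => i i' ii';
  rewrite !inE; apply: down; rewrite le_clawE //=.
by rewrite eqxx.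
Qed.

Lemma encode_valid I : order_ideal I -> valid k (encode I).
Proof.
move=> /forall_inP oI; apply/validP; split=> /= [|i].
  by rewrite -[leqRHS](card_ord k) max_card.
rewrite ffunE; apply: subset_leq_card; apply/subsetP => j; rewrite !inE => xI.
by have /forall_inP := oI _ xI; apply; rewrite le_clawE /=.
Qed.

(** A minimal missing point is the first missing one of its chain. Over a leaf, the bottom point at
    the same height must also be present, which means [c_i < a]. *)
Lemma minimals_setC_ideal_of s (x : P) : valid k s ->
  (x \in minimals (~: ideal_of s)) =
  (if x.1 is Claw_leaf i then (x.2 == s.2 i :> nat) && (s.2 i < s.1)
   else x.2 == s.1 :> nat).
Proof.
move=> /validP[ak ca]; apply/mem_minimals/idP.
  case: x => [[|i] j]; rewrite !inE /= -leqNgt => -[aj mx].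
    rewrite eqn_leq aj andbT.
    have := mx (Claw_bot, Ordinal (leq_ltn_trans aj (ltn_ord j))).
    by rewrite !inE /= ltnn le_clawE /= => /(_ isT aj) [] /= <-.
  have ck := leq_ltn_trans aj (ltn_ord j).
  have ec : j = s.2 i :> nat.
    have := mx (Claw_leaf i, Ordinal ck).
    by rewrite !inE /= ltnn le_clawE /= eqxx => /(_ isT aj) [] /= <-.
  rewrite ec eqxx ltnNge /=; apply/negP => ac.
  have := mx (Claw_bot, j).
  by rewrite !inE /= -leqNgt ec le_clawE /= leqnn => /(_ ac isT).
case: x => [[|i] j] /=.
  move=> /eqP ja; rewrite !inE /= ja ltnn; split=> // -[[|i] j'].
    rewrite !inE le_clawE /= -leqNgt ja => aj ja'; congr pair.
    by apply/val_inj/eqP; rewrite eqn_leq /= ja ja' aj.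
  by rewrite le_clawE.
move=> /andP[/eqP jc cia]; rewrite !inE /= jc ltnn; split=> // -[[|i'] j'].
  by rewrite !inE le_clawE /= -leqNgt jc; lia.
rewrite !inE le_clawE /= -leqNgt jc => + /andP[/eqP ii] => cj jc'.
subst i'; congr pair.
by apply/val_inj/eqP; rewrite eqn_leq /= jc jc' cj.
Qed.

(** A leaf chain with [c_i = a] has no generator above it and becomes empty. If [a < k], the bottom
    chain has its own generator at height [a], which dominates those of the leaves; if [a = k], only
    leaf generators reach it, whence the maximum. *)
Lemma rowmotion_ideal_of s : valid k s ->
  generated_ideal (minimals (~: ideal_of s)) = ideal_of (row k s).
Proof.
move=> vs; have /validP[ak ca] := vs.
apply/setP => -[[|i] j]; rewrite !inE /=; last first.
  rewrite ffunE; apply/exists_inP/idP => [[[[|i'] j']]|].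
  - by rewrite le_clawE.
  - rewrite minimals_setC_ideal_of // le_clawE /=.
    move=> /andP[/eqP jc ca'] /andP[/eqP ii]; subst i'.
    by rewrite ca' ltnS jc.
  case: ifP => // cia; rewrite ltnS => jc.
  exists (Claw_leaf i, Ordinal (leq_trans cia ak)).
    by rewrite minimals_setC_ideal_of //= eqxx.
  by rewrite le_clawE /= eqxx.
apply/exists_inP/idP => [[[[|i] j']]|].
- rewrite minimals_setC_ideal_of // le_clawE /= => /eqP <- jj.
  by rewrite ltn_ord.
- rewrite minimals_setC_ideal_of // le_clawE /= => /andP[/eqP jc cia] jj.
  case: ifP => _; first by lia.
  apply: leq_trans (leq_bigmax i); rewrite ffunE cia ltnS -jc //.
case: ifP => [ak'|ak'].
  rewrite ltnS => ja; exists (Claw_bot, Ordinal ak').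
    by rewrite minimals_setC_ideal_of //= eqxx.
  by rewrite le_clawE.
(* Without leaves the empty maximum is 0, and there is nothing to generate. *)
case: (posnP n) => [n0|n0].
  rewrite big_pred0 // => i.
  by have := ltn_ord i; rewrite {2}n0.
have [|i ->] := bigop.eq_bigmax (fun i => (leaf_step s).2 i).
  by rewrite card_ord.
rewrite ffunE; case: ifP => // cia; rewrite ltnS => jc.
exists (Claw_leaf i, Ordinal (leq_trans cia ak)).
  by rewrite minimals_setC_ideal_of //= eqxx.
by rewrite le_clawE.
Qed.

Lemma encode_rowmotion (I : ideals P) :
  encode (val (rowmotion I)) = row k (encode (val I)).
Proof.
have vI := encode_valid (valP I).
rewrite /= -{1}(encodeK (valP I)) rowmotion_ideal_of // ideal_ofK //.
by apply/bot_step_valid/leaf_step_valid.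
Qed.

Lemma iter_rowmotion_id m :
  iter m (@rowmotion _ P) =1 id <->
  (forall s, valid k s -> iter m (row k) s = s).
Proof.
have sc (J : ideals P) :
    encode (val (iter m (@rowmotion _ P) J)) = iter m (row k) (encode (val J)).
  have hrow (J' : ideals P) of xpredT J' := encode_rowmotion J'.
  by have [] := iter_semiconj (fun _ _ => isT) hrow m (isT : xpredT J).
split=> [idm s vs|idm J].
  pose J : ideals P := Sub (ideal_of s) (ideal_of_order_ideal vs).
  by have := sc J; rewrite idm /= ideal_ofK.
have := sc J; rewrite idm; last exact: encode_valid (valP J).
move=> e; apply: val_inj.
by rewrite -(encodeK (valP (iter m _ J))) e encodeK ?(valP J).
Qed.

End Ideals.

Theorem theorem4p11 (n k : nat) (hn : 1 <= n) (hk : 1 <= k) :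
  is_order (@rowmotion _ (claw n *p 'I_k)%type)
    ((k + 2) * \big[lcmn/1]_(1 <= i < (minn k.+1 n).+1) i).
Proof.
rewrite addn2; split.
- rewrite muln_gt0 /= big_seq; apply: (big_ind (leq 1)) => // [x y|i].
    by rewrite lcmn_gt0 => -> ->.
  by rewrite mem_index_iota => /andP[].
- by apply/iter_rowmotion_id/iter_row_id => s; apply: prom_iter_lcm.
move=> m m0 /iter_rowmotion_id/iter_row_id idm.
exact/dvdn_leq/prom_iter_id_dvdn.
Qed.
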